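(* For every $d>0$ and every positive even integer $N$ there is a constant $C_N(d)>0$ such that, for $c=\frac{d/N}{1+d/N}$ and $\mathbf c=c\,(1,\dots,1)\in\mathbb R^{N-1}$, and for all indices $i\neq j$ either both in $\mathcal I'$ or both in $\mathcal I''$, $$\|B(\mathbf c)^{2N}\mathbf v_{ij}\|_{\ell_1}\le C_N(d)\,\|\mathbf v_{ij}\|_{\ell_1},$$ and $$C_N(d)\to 1-2de^{-2d}<1\qquad\text{as }N\to\infty.$$
   Context: $B_1\in\mathbb R^{2N\times2N}$ is block diagonal with $N$ diagonal blocks $\begin{pmatrix}0&1\\1&0\end{pmatrix}$. For $\mathbf c=(c_1,\dots,c_{N-1})$, $B_2(\mathbf c)\in\mathbb R^{2N\times2N}$ is block diagonal with diagonal blocks $1$, $\begin{pmatrix}c_j&1-c_j\\1-c_j&c_j\end{pmatrix}$ for $j=1,\dots,N-1$ (acting on coordinates $2j,2j+1$), and $1$. $B(\mathbf c)=B_2(\mathbf c)B_1$. Index sets: $\mathcal I'=\{1,4,5,8,\dots,2N-3,2N\}$ (indices congruent to $0$ or $1$ mod $4$) and $\mathcal I''=\{2,3,6,7,\dots,2N-2,2N-1\}$ (indices congruent to $2$ or $3$ mod $4$) in $\{1,\dots,2N\}$. The vector $\mathbf v_{ij}\in\mathbb R^{2N}$ has $i$-th entry $1$, $j$-th entry $-1$ and all other entries $0$. $\|\cdot\|_{\ell_1}$ is the sum of absolute values of the entries. *)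

(* Defs.v *)
From HB Require Import structures.
From mathcomp Require Import all_boot all_order all_algebra.
From mathcomp Require Import all_classical all_reals all_analysis.

Set Implicit Arguments.
Unset Strict Implicit.
Unset Printing Implicit Defensive.

Import Order.TTheory GRing.Theory Num.Theory.
Import numFieldNormedType.Exports.

Local Open Scope ring_scope.

(* Ordinals count from 0: the coordinate k of 1, ..., 2N is the ordinal of
   value k.-1 in 'I_(2 * N), and the entry c_j of c is c 0 (j.-1). *)

(* The coordinates 2k+1, 2k+2 (values 2k, 2k.+1) form the k-th diagonal block
   of B1; i./2 is the index of the block that contains i. *)
Definition B1 (R : realType) (N : nat) : 'M[R]_(2 * N) :=
  \matrix_(i < 2 * N, j < 2 * N)
    if i./2 == j./2 then (if i == j then 0 else 1) else 0.

(* c_j for 1 <= j <= N.-1; the value outside this range is not used by B2. *)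
Definition centry (R : realType) (N : nat) (c : 'rV[R]_(N.-1)) (j : nat) : R :=
  if insub j.-1 is Some k then c 0 k else 0.

(* The diagonal blocks of B2 are numbered 0, ..., N: the blocks 0 and N are the
   1 x 1 blocks on the coordinates 1 and 2N, and for 0 < k < N the block k
   occupies the coordinates 2k, 2k+1 (values 2k.-1, 2k); uphalf i is the
   number of the block that contains i. *)
Definition B2 (R : realType) (N : nat) (c : 'rV[R]_(N.-1)) : 'M[R]_(2 * N) :=
  \matrix_(i < 2 * N, j < 2 * N)
    if uphalf i == uphalf j then
      if (uphalf i == 0%N) || (uphalf i == N) then 1
      else if i == j then centry c (uphalf i) else 1 - centry c (uphalf i)
    else 0.

Definition B (R : realType) (N : nat) (c : 'rV[R]_(N.-1)) : 'M[R]_(2 * N) :=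
  B2 c *m B1 R N.

Definition I' (N : nat) : {set 'I_(2 * N)} :=
  [set i : 'I_(2 * N) | (i.+1 %% 4 == 0)%N || (i.+1 %% 4 == 1)%N].

Definition I'' (N : nat) : {set 'I_(2 * N)} :=
  [set i : 'I_(2 * N) | (i.+1 %% 4 == 2)%N || (i.+1 %% 4 == 3)%N].

Definition vij (R : realType) (N : nat) (i j : 'I_(2 * N)) : 'cV[R]_(2 * N) :=
  \col_(k < 2 * N) if k == i then 1 else if k == j then -1 else 0.

Definition l1norm (R : realType) (n : nat) (v : 'cV[R]_n) : R :=
  \sum_(k < n) `|v k 0|.

(* Main.v *)
Require Import Defs.
From mathcomp Require Import all_boot all_order all_algebra.
From mathcomp Require Import all_classical all_reals all_analysis.
From mathcomp Require Import zify ring.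

Import Order.TTheory GRing.Theory Num.Theory.
Import numFieldNormedType.Exports.

Local Open Scope classical_set_scope.
Local Open Scope ring_scope.

(** Read the columns of B(c) as the law of one step of a random walk on the
    2N sites. With W1 = B1 and W2 = B2(0), both involutive permutations,
    B2(c) = (1 - c) W2 + c 1: this also holds on the two 1 x 1 blocks, where
    W2 is the identity. Hence (lemma [B_constE])

      B(c) = (1 - c) S + c F,   S = W2 W1,   F = W1,

    and the walk follows S with probability 1 - c and takes the reflected step F
    with probability c. The permutation S runs through all the sites in a single
    cycle, so S^(2N) = 1, and S F S = F: S and F generate a dihedral group.

    Among the words of length 2N in S and F, keep those with exactly one F:

      T = sum over t < 2N of S^(2N-1-t) F S^t.

    The dihedral relations give T S^2 = T ([one_flip_sum_shift]): a walk
    reflected once, at a uniform time, forgets where it started, except for the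
    parity of its position on the cycle. The sets I' and I'' are the two parity
    classes ([rot_site_orbit]), so T v_ij = 0 for i and j in the same class
    ([one_flip_sum_delta]).

    Put g = c (1 - c)^(2N-1). Then B(c)^(2N) v_ij = (B(c)^(2N) - g T) v_ij. The
    matrix B(c)^(2N) - g T collects the remaining words, so its entries are
    nonnegative, and its column sums are 1 - 2N g. It therefore contracts the l1
    norm by C_N = 1 - 2N g ([l1norm_contract]).

    Here 2N g is the probability of exactly one success in 2N trials with
    c = (d/N)/(1 + d/N). It equals 2d (1 + d/N)^(-2N), which tends to
    2d exp(-2d) ([one_flip_prob_cvg]). *)

(** * Words with exactly one occurrence of the second letter *)

Definition one_flip_sum {A : pzRingType} (n : nat) (x y : A) : A :=
  \sum_(t < n) x ^+ (n.-1 - t) * y * x ^+ t.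

Lemma one_flip_sumS (A : pzRingType) (n : nat) (x y : A) :
  one_flip_sum n.+1 x y = x * one_flip_sum n x y + y * x ^+ n.
Proof.
rewrite /one_flip_sum big_ord_recr /= subnn expr0 mul1r; congr (_ + _).
rewrite big_distrr /=; apply: eq_bigr => t _; rewrite !mulrA -exprS.
by congr (_ ^+ _ * _ * _); have := ltn_ord t; lia.
Qed.

(** In the expansion of [(x + y) ^+ n], what is left after removing the words
    with zero or one [y] is still a sum of words in [x] and [y]. *)
Lemma exprD_sub_one_flip (A : pzRingType) (P : {pred A}) (x y : A) (n : nat) :
  GRing.semiring_closed P -> x \in P -> y \in P ->
  (x + y) ^+ n - x ^+ n - one_flip_sum n x y \in P.
Proof.
move=> [[P0 PD] [P1 PM]] xP yP.
have xXP (k : nat) : x ^+ k \in P.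
  by elim: k => [|k IH]; rewrite ?expr0 // exprS PM.
have TP (k : nat) : one_flip_sum k x y \in P.
  by rewrite /one_flip_sum; elim/big_ind: _ => // t _; rewrite !PM.
elim: n => [|n IH].
  by rewrite /one_flip_sum big_ord0 !expr0 !subrr.
have -> : (x + y) ^+ n.+1 - x ^+ n.+1 - one_flip_sum n.+1 x y =
    (x + y) * ((x + y) ^+ n - x ^+ n - one_flip_sum n x y)
    + y * one_flip_sum n x y.
  rewrite one_flip_sumS !exprS !mulrBr !mulrDl.
  set a := x * (x + y) ^+ n; set b := y * (x + y) ^+ n; set e := x * x ^+ n.
  set f := y * x ^+ n; set g := x * _; set h := y * _.
  by rewrite !opprD !addrA subrK addrAC.
by apply: (PD); apply: (PM) => //; apply: (PD).
Qed.

(** Right multiplication by [r ^+ 2] moves the reflection [f] one step later: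
    [f * r ^+ t.+2 = r^-1 * f * r ^+ t.+1]. The term that leaves the sum at one
    end comes back at the other because [r ^+ n = 1]. *)
Lemma one_flip_sum_shift (A : pzRingType) (n : nat) (r f : A) :
  r ^+ n = 1 -> r * f * r = f ->
  one_flip_sum n r f * r ^+ 2 = one_flip_sum n r f.
Proof.
move=> rn1 rfr; case: n rn1 => [|m] rm1; rewrite /one_flip_sum.
  by rewrite big_ord0 mul0r.
rewrite big_distrl /= big_ord_recr [RHS]big_ord_recl /= addrC.
congr (_ + _).
  (* Both boundary terms are equal to f * r. *)
  rewrite subn0 subnn !expr0 mul1r mulr1 -{2}rfr -!mulrA -exprD addn2.
  by rewrite exprS rm1 mulr1 !mulrA -exprSr rm1 mul1r.
apply: eq_bigr => t _; rewrite /bump leq0n add1n -!mulrA -exprD addn2.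
have -> : (m - t = (m - t.+1).+1)%N by have := ltn_ord t; lia.
by rewrite -{2}rfr exprSr exprS !mulrA.
Qed.

Lemma one_flip_sum_comm (A : comPzRingType) (n : nat) (x y : A) :
  one_flip_sum n x y = x ^+ n.-1 * y *+ n.
Proof.
rewrite /one_flip_sum (eq_bigr (fun=> x ^+ n.-1 * y)) ?sumr_const ?card_ord //.
move=> t _; rewrite mulrAC -exprD; congr (_ ^+ _ * _).
by have := ltn_ord t; lia.
Qed.

(** * Nonnegative matrices with constant column sums *)

(** The row vector [const_mx 1] on the left computes the column sums. *)
Lemma l1norm_contract (R : realType) (n : nat) (M : 'M[R]_n) (v : 'cV[R]_n)
    (q : R) :
  M \is a mxOver Num.nneg -> const_mx 1 *m M = const_mx q :> 'rV_n ->
  l1norm (M *m v) <= q * l1norm v.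
Proof.
move=> /mxOverP M0 colM; rewrite /l1norm.
apply: (@le_trans _ _ (\sum_(i < n) \sum_(j < n) M i j * `|v j 0|)).
  apply: ler_sum => i _; rewrite mxE; apply: (le_trans (ler_norm_sum _ _ _)).
  apply: ler_sum => j _; rewrite normrM ger0_norm //.
  exact: M0.
rewrite exchange_big mulr_sumr /=; apply: ler_sum => j _.
rewrite -mulr_suml; move/matrixP: colM => /(_ 0 j); rewrite !mxE => <-.
by under [in leRHS]eq_bigr do rewrite mxE mul1r.
Qed.

Lemma mxOver_nneg_semiring_closed (R : realType) (n : nat) :
  GRing.semiring_closed (mxOver Num.nneg : {pred 'M[R]_n}).
Proof.
split; split=> [|M M'].
- by apply/mxOverP => i j; rewrite mxE nnegrE.
- move=> /mxOverP MP /mxOverP MP'; apply/mxOverP => i j.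
  by rewrite mxE rpredD ?MP ?MP'.
- by apply/mxOverP => i j; rewrite mxE nnegrE ler0n.
exact: mxOverM.
Qed.

Lemma mxOver_exprD_sub_one_flip (R : realType) (n m : nat) (x y : 'M[R]_n) :
  x \is a mxOver Num.nneg -> y \is a mxOver Num.nneg ->
  (x + y) ^+ m - one_flip_sum m x y \is a mxOver Num.nneg.
Proof.
move=> xP yP; have closedP := mxOver_nneg_semiring_closed R n.
have xmP : x ^+ m \is a mxOver Num.nneg.
  elim: m => [|k IH]; first by case: closedP => _ [].
  by rewrite exprS -mulmxE mxOverM.
have rP := exprD_sub_one_flip _ _ _ _ m closedP xP yP.
rewrite -[_ ^+ m](subrK (x ^+ m)) addrAC.
by case: closedP => [[_ PD] _]; exact: PD.
Qed.

Lemma one_flip_sum_mxZ (R : realType) (n m : nat) (x y : 'M[R]_n) (a b : R) :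
  one_flip_sum m (a *: x) (b *: y) = (a ^+ m.-1 * b) *: one_flip_sum m x y.
Proof.
have expZ (k : nat) : (a *: x) ^+ k = a ^+ k *: x ^+ k.
  elim: k => [|k IH]; first by rewrite !expr0 scale1r.
  by rewrite !exprS IH -!mulmxE -scalemxAl -scalemxAr scalerA.
rewrite /one_flip_sum scaler_sumr; apply: eq_bigr => t _.
rewrite !expZ -!mulmxE -!scalemxAl -!scalemxAr -!scalemxAl !scalerA.
congr (_ *: _); rewrite mulrA -exprD.
by congr (_ ^+ _ * _); have := ltn_ord t; lia.
Qed.

Lemma one_flip_sum_colsum (R : realType) (n m : nat) (x y : 'M[R]_n) :
  const_mx 1 *m x = const_mx 1 :> 'rV_n ->
  const_mx 1 *m y = const_mx 1 :> 'rV_n ->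
  const_mx 1 *m one_flip_sum m x y = const_mx m%:R :> 'rV_n.
Proof.
move=> ux uy; have ux_exp (k : nat) : const_mx 1 *m x ^+ k = const_mx 1 :> 'rV_n.
  by elim: k => [|k IH]; rewrite ?expr0 ?mulmx1 // exprS -mulmxE mulmxA ux.
rewrite /one_flip_sum mulmx_sumr (eq_bigr (fun=> const_mx 1)); last first.
  by move=> t _; rewrite -!mulmxE !mulmxA ux_exp uy ux_exp.
rewrite sumr_const card_ord; apply/rowP => j.
by rewrite mulmxnE !mxE.
Qed.

(** * Matrices of self-maps *)

(** Column [j] is the unit vector of index [f j], so that composition of maps
    becomes the matrix product in the same order. *)
Definition funmx (R : realType) {n : nat} (f : 'I_n -> 'I_n) : 'M[R]_n :=
  \matrix_(i, j) (i == f j)%:R.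

Lemma funmx_nneg (R : realType) (n : nat) (f : 'I_n -> 'I_n) :
  funmx R f \is a mxOver Num.nneg.
Proof. by apply/mxOverP => i j; rewrite mxE nnegrE ler0n. Qed.

Lemma funmx_colsum (R : realType) (n : nat) (f : 'I_n -> 'I_n) :
  const_mx 1 *m funmx R f = const_mx 1 :> 'rV_n.
Proof.
apply/rowP => j; rewrite !mxE (bigD1 (f j)) //= !mxE eqxx mul1r big1 ?addr0 //.
by move=> i /negPf ij; rewrite !mxE ij mulr0.
Qed.

Lemma funmx_delta (R : realType) (n : nat) (f : 'I_n -> 'I_n) (j : 'I_n) :
  funmx R f *m delta_mx j 0 = delta_mx (f j) 0 :> 'cV_n.
Proof. by rewrite -colE; apply/colP => i; rewrite !mxE eqxx andbT. Qed.

Lemma funmx_exp_delta (R : realType) (n k : nat) (f : 'I_n -> 'I_n) (j : 'I_n) :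
  funmx R f ^+ k *m delta_mx j 0 = delta_mx (iter k f j) 0 :> 'cV_n.
Proof.
elim: k => [|k IH]; first by rewrite expr0 mul1mx.
by rewrite exprS -mulmxE -mulmxA IH funmx_delta.
Qed.

Lemma eq_mx_delta (R : realType) (n : nat) (M M' : 'M[R]_n) :
  (forall j, M *m delta_mx j 0 = M' *m delta_mx j 0 :> 'cV_n) -> M = M'.
Proof.
by move=> h; apply/matrixP => i j; have /colP/(_ i) := h j; rewrite -!colE !mxE.
Qed.

(** * The two matchings of the sites *)

(** The matching of the 2 x 2 blocks of [B1]. *)
Definition mate1 {N : nat} (i : 'I_(2 * N)) : 'I_(2 * N) :=
  insubd i (if odd i then i.-1 else i.+1).

(** The matching of the blocks of [B2]. The two end sites are fixed: the first
    because [0.-1 = 0], the last by the default value of [insubd]. *)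
Definition mate2 {N : nat} (i : 'I_(2 * N)) : 'I_(2 * N) :=
  insubd i (if odd i then i.+1 else i.-1).

Lemma val_mate1 (N : nat) (i : 'I_(2 * N)) :
  mate1 i = (if odd i then i.-1 else i.+1) :> nat.
Proof.
rewrite val_insubd; have i2N := ltn_ord i.
have [odd_i|even_i] := boolP (odd i); first by rewrite ifT //; lia.
by rewrite ifT //; lia.
Qed.

Lemma val_mate2 (N : nat) (i : 'I_(2 * N)) :
  mate2 i = (if odd i then if i.+1 < 2 * N then i.+1 else i : nat else i.-1)%N
  :> nat.
Proof.
rewrite val_insubd; have i2N := ltn_ord i; case: (odd i) => //.
by rewrite ifT //; lia.
Qed.

Lemma mate1K (N : nat) : involutive (@mate1 N).
Proof.
move=> i; apply: val_inj; rewrite /= !val_mate1.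
by case: (boolP (odd i)) => ?; case: ifP; lia.
Qed.

Lemma mate2K (N : nat) : involutive (@mate2 N).
Proof.
move=> i; apply: val_inj; rewrite /= !val_mate2; have i2N := ltn_ord i.
case: (boolP (odd i)) => ?; last by case: ifP => ?; [case: ifP|]; lia.
by case: (ltnP i.+1 (2 * N)) => ?; case: ifP => ?; [case: ifP| |case: ifP|]; lia.
Qed.

Lemma B1E (R : realType) (N : nat) : B1 R N = funmx R mate1.
Proof.
apply/matrixP => i j; rewrite !mxE -!val_eqE /= val_mate1.
have -> : (i == (if odd j then j.-1 else j.+1) :> nat) =
    (i./2 == j./2) && (i != j :> nat) by case: ifP => ?; lia.
by case: (_ == _); case: (_ == _).
Qed.

(** On a 1 x 1 block the right-hand side is [(1 - c) + c = 1], so the ends need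
    no separate treatment afterwards. *)
Lemma B2_constE (R : realType) (N : nat) (c : R) :
  B2 (const_mx c : 'rV_N.-1) = (1 - c) *: funmx R mate2 + c *: 1%:M.
Proof.
apply/matrixP => i j; have i2N := ltn_ord i; have j2N := ltn_ord j.
have c_eq (k : nat) : (0 < k < N)%N -> centry (const_mx c : 'rV_N.-1) k = c.
  move=> kN; rewrite /centry; case: insubP => [u _ _|]; first by rewrite mxE.
  by move: kN; lia.
rewrite !mxE -!val_eqE /= val_mate2.
set p := (X in (i == X :> nat)%:R).
have pE : (i == p :> nat) = (uphalf i == uphalf j) &&
    (((uphalf i == 0%N) || (uphalf i == N)) || (i != j :> nat)).
  by rewrite /p; case: (boolP (odd j)) => ?; [case: ltnP => ?|]; lia.
have ij_half : i = j :> nat -> uphalf i = uphalf j by move->.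
have ij_end : uphalf i = uphalf j -> (uphalf i == 0%N) || (uphalf i == N) ->
  i = j :> nat by lia.
rewrite pE; case: eqP => [hu|hu]; last first.
  by rewrite (_ : (i == j :> nat) = false) ?mulr0 ?addr0 //; apply/eqP => /ij_half.
case: ifPn => hend /=; first by rewrite ij_end // eqxx !mulr1 subrK.
rewrite c_eq; last by move: hend hu; lia.
by case: eqP; rewrite /= ?mulr0 ?mulr1 ?addr0 ?add0r.
Qed.

(** * The cycle through all the sites *)

Definition rot_site {N : nat} (i : 'I_(2 * N)) : 'I_(2 * N) := mate2 (mate1 i).

(** From the first site the cycle visits the even values in increasing order,
    turns at the last site and comes back through the odd values. *)
Lemma val_iter_rot_site (N k : nat) (o : 'I_(2 * N)) :
  o = 0 :> nat -> (k < 2 * N)%N ->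
  iter k rot_site o = (if k < N then k.*2 else (4 * N - 1 - k.*2))%N :> nat.
Proof.
move=> o0; elim: k => [|k IH] kN; first by rewrite /= o0 ifT //; lia.
rewrite iterS /rot_site val_mate2 !val_mate1 IH; last lia.
case: (ltnP k N) => kN'.
  rewrite odd_double /= odd_double /=.
  by case: (ltnP _ (2 * N)) => ?; case: (ltnP k.+1 N) => ?; lia.
rewrite (_ : odd (4 * N - 1 - k.*2) = true); last lia.
by rewrite ifF ?ifF; lia.
Qed.

(** The congruences mod 4 that define [I'] and [I''] are the two parities of
    the position on the cycle. *)
Lemma rot_site_orbit (N : nat) (o i : 'I_(2 * N)) : o = 0 :> nat ->
  exists2 k : nat, iter k rot_site o = i &
    odd k = (i.+1 %% 4 == 2)%N || (i.+1 %% 4 == 3)%N.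
Proof.
move=> o0; have i2N := ltn_ord i.
have [odd_i|even_i] := boolP (odd i).
  exists (2 * N - i.+1./2)%N; last lia.
  by apply: val_inj; rewrite /= val_iter_rot_site ?ifF //; lia.
exists i./2; last lia.
by apply: val_inj; rewrite /= val_iter_rot_site ?ifT //; lia.
Qed.

Lemma rot_site_full_turn (N : nat) (i : 'I_(2 * N)) :
  iter (2 * N) rot_site i = i.
Proof.
have N0 : (0 < 2 * N)%N by apply: leq_ltn_trans (ltn_ord i).
(* All sites are on the orbit of o, so it is enough to follow o. *)
pose o := Ordinal N0; have [k <- _] := rot_site_orbit N o i erefl.
rewrite -iterD addnC iterD; congr iter; apply: val_inj.
rewrite -[X in iter X](prednK N0) iterS /= /rot_site val_mate2 !val_mate1.
rewrite val_iter_rot_site //; last lia.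
case: (ltnP (2 * N).-1 N) => [|_]; first lia.
rewrite (_ : odd (4 * N - 1 - _) = true); last lia.
by rewrite ifF /=; lia.
Qed.

(** * The dihedral structure of the step matrix *)

Definition rotmx (R : realType) (N : nat) : 'M[R]_(2 * N) := funmx R rot_site.

Lemma B_constE (R : realType) (N : nat) (c : R) :
  B (const_mx c : 'rV_N.-1) = (1 - c) *: rotmx R N + c *: B1 R N.
Proof.
rewrite /B B2_constE mulmxDl -!scalemxAl mul1mx; congr (_ *: _ + _).
apply: eq_mx_delta => j.
by rewrite -mulmxA B1E /rotmx !funmx_delta.
Qed.

Lemma rotmx_full_turn (R : realType) (N : nat) : rotmx R N ^+ (2 * N) = 1.
Proof.
by apply: eq_mx_delta => j; rewrite funmx_exp_delta rot_site_full_turn mul1mx.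
Qed.

(** With S = W2 W1, this is W2 W1 W1 W2 W1 = W1. *)
Lemma rotmx_B1_rotmx (R : realType) (N : nat) :
  rotmx R N * B1 R N * rotmx R N = B1 R N.
Proof.
apply: eq_mx_delta => j.
by rewrite -!mulmxE -!mulmxA B1E /rotmx !funmx_delta /rot_site mate1K mate2K.
Qed.

(** The walk reflected exactly once depends on its starting site only through
    the parity of the position of that site on the cycle. *)
Lemma one_flip_sum_delta (R : realType) (N : nat) (i j : 'I_(2 * N)) :
  ((i \in I' N) && (j \in I' N)) || ((i \in I'' N) && (j \in I'' N)) ->
  one_flip_sum (2 * N) (rotmx R N) (B1 R N) *m (delta_mx i 0 - delta_mx j 0)
  = 0 :> 'cV_(2 * N).
Proof.
set T := one_flip_sum _ _ _.
have N0 : (0 < 2 * N)%N by apply: leq_ltn_trans (ltn_ord i).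
pose o := Ordinal N0.
have T2k (k : nat) (r : 'M[R]_(2 * N)) : T *m (rotmx R N ^+ k.*2 *m r) = T *m r.
  elim: k r => [|k IH] r; first by rewrite expr0 mul1mx.
  rewrite doubleS -(addn2 k.*2) exprD -mulmxE -mulmxA IH mulmxA; congr (_ *m _).
  exact: one_flip_sum_shift (rotmx_full_turn R N) (rotmx_B1_rotmx R N).
have Tdelta (k : nat) : T *m delta_mx (iter k rot_site o) 0 =
    T *m rotmx R N ^+ (odd k) *m delta_mx o 0 :> 'cV_(2 * N).
  rewrite -funmx_exp_delta mulmxA -{1}(odd_double_half k) addnC exprD -mulmxE.
  by rewrite T2k.
have [k <- ki] := rot_site_orbit N o i erefl.
have [l <- lj] := rot_site_orbit N o j erefl.
rewrite !inE => same_class.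
have kl : odd k = odd l by rewrite ki lj; move: same_class; lia.
by rewrite mulmxBr !Tdelta kl subrr.
Qed.

(** * Contraction after a full turn *)

Definition one_flip_prob {R : realType} (c : R) (n : nat) : R :=
  (1 - c) ^+ n.-1 * c *+ n.

(** The binomial expansion of [((1 - c) + c) ^+ n = 1] also contains the
    positive term [(1 - c) ^+ n]. *)
Lemma one_flip_prob_lt1 (R : realType) (c : R) (n : nat) :
  0 < c < 1 -> one_flip_prob c n < 1.
Proof.
move=> /andP[c0 c1]; have c1' : 0 < 1 - c by rewrite subr_gt0.
have nnegP : GRing.semiring_closed (Num.nneg : {pred R}).
  split; split=> [|a b]; rewrite ?rpred0 ?rpred1 //.
    exact: rpredD.
  exact: rpredM.
have xP : 1 - c \is Num.nneg by rewrite nnegrE ltW.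
have yP : c \is Num.nneg by rewrite nnegrE ltW.
have := exprD_sub_one_flip _ _ _ _ n nnegP xP yP.
rewrite nnegrE subrK expr1n one_flip_sum_comm.
rewrite addrAC subr_ge0 -[_ < 1]subr_gt0; apply: lt_le_trans.
by rewrite exprn_gt0.
Qed.

Lemma l1norm_full_turn (R : realType) (N : nat) (c : R) (i j : 'I_(2 * N)) :
  0 < c < 1 ->
  ((i \in I' N) && (j \in I' N)) || ((i \in I'' N) && (j \in I'' N)) ->
  l1norm (B (const_mx c : 'rV_N.-1) ^+ (2 * N) *m (delta_mx i 0 - delta_mx j 0))
  <= (1 - one_flip_prob c (2 * N)) *
     l1norm (delta_mx i 0 - delta_mx j 0 : 'cV[R]_(2 * N)).
Proof.
move=> /andP[c0 c1] same_class; set v := _ - _.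
set n := (2 * N)%N; set g := (1 - c) ^+ n.-1 * c.
set T := one_flip_sum n (rotmx R N) (B1 R N).
have -> : B (const_mx c : 'rV_N.-1) ^+ n *m v =
    (B (const_mx c : 'rV_N.-1) ^+ n - g *: T) *m v.
  by rewrite mulmxBl -scalemxAl one_flip_sum_delta // scaler0 subr0.
have c1' : 0 <= 1 - c by rewrite subr_ge0 ltW.
have xP : (1 - c) *: rotmx R N \is a mxOver Num.nneg.
  by rewrite mxOverZ ?nnegrE ?funmx_nneg.
have yP : c *: B1 R N \is a mxOver Num.nneg.
  by rewrite mxOverZ ?nnegrE ?B1E ?funmx_nneg // ltW.
apply: l1norm_contract.
  rewrite B_constE /g /T -one_flip_sum_mxZ.
  exact: mxOver_exprD_sub_one_flip.
have uB : const_mx 1 *m B (const_mx c : 'rV_N.-1) = const_mx 1 :> 'rV[R]_n.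
  rewrite B_constE mulmxDr -!scalemxAr B1E !funmx_colsum -scalerDl.
  by rewrite subrK scale1r.
have uBk (k : nat) :
    const_mx 1 *m B (const_mx c : 'rV_N.-1) ^+ k = const_mx 1 :> 'rV[R]_n.
  by elim: k => [|k IH]; rewrite ?expr0 ?mulmx1 // exprS -mulmxE mulmxA uB.
rewrite mulmxBr uBk -scalemxAr one_flip_sum_colsum ?B1E ?funmx_colsum //.
by apply/rowP => k; rewrite !mxE mulr_natr.
Qed.

Lemma vijE (R : realType) (N : nat) (i j : 'I_(2 * N)) : i != j ->
  vij R i j = delta_mx i 0 - delta_mx j 0.
Proof.
move=> ij; apply/colP => k; rewrite !mxE !andbT.
have [->|ki] := eqVneq k i; first by rewrite (negPf ij) subr0.
by rewrite sub0r; case: (k == j); rewrite ?oppr0.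
Qed.

(** * The limit of the contraction factor *)

(** With [y = d / N] the probability is [2 * d * (1 + y) ^- (2 * N)]. The bounds
    [1 + y <= expR y] and [1 - y / (1 + y) <= expR (- (y / (1 + y)))] enclose
    the last factor between [expR (- (2 * d))] and
    [expR (- (2 * d) / (1 + y))]. *)
Lemma one_flip_prob_cvg (R : realType) (d : R) : 0 < d ->
  one_flip_prob ((d / N%:R) / (1 + d / N%:R)) (2 * N) @[N --> \oo]
  --> 2 * d * expR (- (2 * d)).
Proof.
move=> d0.
apply: (@squeeze_cvgr _ _ _ _ (fun=> 2 * d * expR (- (2 * d)))
  (fun N : nat => 2 * d * expR (- (2 * d) / (1 + d / N%:R)))).
- near=> N.
  have N0 : (0 : R) < N%:R by rewrite ltr0n; near: N; exists 1%N.
  set y := d / N%:R; have y0 : 0 < y by rewrite divr_gt0.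
  have y1 : 0 < 1 + y by rewrite addr_gt0.
  have -> : one_flip_prob (y / (1 + y)) (2 * N) =
      2 * d * ((1 + y)^-1 ^+ (2 * N)).
    rewrite /one_flip_prob.
    have -> : 1 - y / (1 + y) = (1 + y)^-1 by field; rewrite gt_eqF.
    rewrite -mulr_natr natrM.
    have -> : 2 * d = y * (2 * N%:R) by rewrite /y; field; rewrite gt_eqF.
    have n0 : (0 < 2 * N)%N by rewrite muln_gt0 /= -(ltr0n R).
    rewrite -[in RHS](prednK n0) exprSr; ring.
  have dE : 2 * d = y * (2 * N)%:R by rewrite /y natrM; field; rewrite gt_eqF.
  rewrite !ler_pM2l ?mulr_gt0 //; apply/andP; split.
    rewrite dE -mulNr expRM_natr expRN.
    apply: lerXn2r; rewrite ?nnegrE ?invr_ge0 ?expR_ge0 ?(ltW y1) //.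
    by rewrite lef_pV2 ?posrE ?expR_gt0 ?expR_ge1Dx.
  rewrite dE -mulNr mulrAC expRM_natr.
  apply: lerXn2r; rewrite ?nnegrE ?invr_ge0 ?expR_ge0 ?(ltW y1) //.
  apply: le_trans (expR_ge1Dx _); rewrite le_eqVlt; apply/orP; left.
  by apply/eqP; field; rewrite gt_eqF.
- exact: cvg_cst.
apply: cvgMr; apply: continuous_cvg; first exact: continuous_expR.
rewrite -[X in _ --> X]divr1; apply: cvgMr; apply: cvgV; first exact: oner_neq0.
rewrite -[X in _ --> X]addr0; apply: cvgD; first exact: cvg_cst.
rewrite -[X in _ --> X](mulr0 d); apply: cvgMr.
apply/gtr0_cvgV0.
  by near=> N; rewrite ltr0n; near: N; exists 1%N.
exact: cvgr_idn.
Unshelve. all: by end_near. Qed.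

Theorem proposition5p8 (R : realType) (d : R) (hd : 0 < d) :
  exists C : nat -> R,
    [/\ forall N : nat, (0 < N)%N -> ~~ odd N ->
          0 < C N /\
          let c : R := (d / N%:R) / (1 + d / N%:R) in
          let cc : 'rV[R]_(N.-1) := const_mx c in
          forall i j : 'I_(2 * N), i != j ->
            ((i \in I' N) && (j \in I' N)) || ((i \in I'' N) && (j \in I'' N)) ->
            l1norm (B cc ^+ (2 * N) *m vij R i j) <= C N * l1norm (vij R i j),
        (C m.*2) @[m --> \oo] --> (1 - 2 * d * expR (- (2 * d)) : R)
      & 1 - 2 * d * expR (- (2 * d)) < 1].
Proof.
exists (fun N => 1 - one_flip_prob ((d / N%:R) / (1 + d / N%:R)) (2 * N)).
split.
- move=> N N0 _; set c := _ / _.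
  have y0 : 0 < d / N%:R by rewrite divr_gt0 ?ltr0n.
  have y1 : 0 < 1 + d / N%:R by rewrite addr_gt0.
  have c01 : 0 < c < 1.
    by rewrite /c divr_gt0 //= ltr_pdivrMr // mul1r ltrDr.
  split; first by rewrite subr_gt0 one_flip_prob_lt1.
  by move=> /= i j ij same_class; rewrite vijE //; exact: l1norm_full_turn.
- apply: cvgB; first exact: cvg_cst.
  have double_cvg : m.*2 @[m --> \oo] --> \oo.
    by move=> P [n _ nP]; exists n => // m /= nm; apply: nP => /=; lia.
  exact: cvg_comp double_cvg (one_flip_prob_cvg R d hd).
by rewrite gtrBl !mulr_gt0 ?expR_gt0.
Qed.
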